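(* Let $G$ be a planar graph of girth at least $8$. Then every $3$-fold correspondence-cover of $G$ has two vertex-disjoint independent transversals (i.e. two disjoint correspondence-colorings).
   Context: All graphs are finite and simple. A correspondence-cover of a graph $G$ is a pair $(L,H)$ where $H$ is a graph and $L$ maps each $v\in V(G)$ to a subset $L(v)\subseteq V(H)$ such that: the sets $L(v)$ partition $V(H)$; each $L(v)$ induces a clique in $H$; if $uv\notin E(G)$ there are no edges of $H$ between $L(u)$ and $L(v)$; if $uv\in E(G)$ the edges of $H$ between $L(u)$ and $L(v)$ form a matching. The cover is $k$-fold if $|L(v)|=k$ for all $v$. An independent transversal (correspondence-coloring) of $(L,H)$ is an independent set of $H$ containing exactly one vertex of each $L(v)$. *)

(* Defs.v *)
From mathcomp Require Import all_boot.
Set Implicit Arguments.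
Unset Strict Implicit.
Unset Printing Implicit Defensive.

Record sgraph (T : finType) := SGraph {
  adj : rel T;
  adj_sym : symmetric adj;
  adj_irr : irreflexive adj }.

Section Planarity.
Variables (T : finType) (G : sgraph T).

Definition dart := {x : T * T | adj G x.1 x.2}.

Definition dart_tail (d : dart) : T := (val d).1.

Lemma rev_dart_proof (d : dart) : adj G (val d).2 (val d).1.
Proof. by rewrite adj_sym; exact: (valP d). Qed.

Definition rev_dart (d : dart) : dart :=
  exist _ ((val d).2, (val d).1) (rev_dart_proof d).

Definition rotation_system (sigma : dart -> dart) : Prop :=
  [/\ injective sigma,
      forall d, dart_tail (sigma d) = dart_tail d &
      forall d d', dart_tail d = dart_tail d' -> fconnect sigma d d'].

Definition face_perm (sigma : dart -> dart) (d : dart) : dart :=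
  sigma (rev_dart d).

Definition map_link (sigma : dart -> dart) : rel dart :=
  fun d d' => (d' == sigma d) || (d' == rev_dart d).

(* Euler's formula for a genus-0 combinatorial map (as for hypermaps in the
   Four Colour Theorem formalization):
   #nodes + #edges + #faces = 2 * #components + #darts. *)
Definition genus0 (sigma : dart -> dart) : Prop :=
  fcard sigma predT + fcard rev_dart predT + fcard (face_perm sigma) predT
  = 2 * n_comp (connect (map_link sigma)) predT + #|predT : {pred dart}|.

Definition planar : Prop :=
  exists sigma : dart -> dart, rotation_system sigma /\ genus0 sigma.

Definition girth_ge (g : nat) : Prop :=
  forall s : seq T, uniq s -> 3 <= size s -> cycle (adj G) s -> g <= size s.

End Planarity.

Section Correspondence.
Variables (T : finType) (G : sgraph T) (HT : finType) (H : sgraph HT)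
          (L : T -> {set HT}).

Definition corr_cover : Prop :=
  [/\ (forall x : HT, exists v, x \in L v),
      (forall u v, u != v -> [disjoint L u & L v]),
      (forall v x y, x \in L v -> y \in L v -> x != y -> adj H x y),
      (forall u v x y, u != v -> ~~ adj G u v -> x \in L u -> y \in L v ->
          ~~ adj H x y) &
      (forall u v, adj G u v -> forall x, x \in L u ->
          #|[set y in L v | adj H x y]| <= 1)].

Definition k_fold (k : nat) : Prop := forall v, #|L v| = k.

Definition indep_transversal (I : {set HT}) : Prop :=
  (forall x y, x \in I -> y \in I -> ~~ adj H x y) /\
  (forall v, #|I :&: L v| = 1).

End Correspondence.

(* Main.v *)
Require Import Defs.
From mathcomp Require Import all_boot all_fingroup zify.

Set Implicit Arguments.
Unset Strict Implicit.
Unset Printing Implicit Defensive.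

(** Two disjoint colorings amount to choosing at each vertex one of the 6 ordered
    pairs of distinct colors. A colored neighbor of [v] forbids at most 3 pairs
    at [v]. A neighbor of degree 2 whose other neighbor is colored forbids at most
    one: it is stuck only when its two neighbors show it swapped pairs. Hence if
    [v] has [h] neighbors of degree at least 3 and [l] neighbors of degree at most
    2, with [3 h + l < 6], any coloring of the graph without [v] and its [l] light
    neighbors extends. If no vertex of a subgraph [G[S]] is reducible in this way,
    then giving 1/3 from each vertex to each of its neighbors of degree 2 leaves
    everyone with charge at least 8/3, whereas Euler's formula and girth 8 bound
    the average degree strictly below 8/3.

    Euler's formula is needed for [G[S]], not for [G]: deleting an edge composes
    the edge involution, and the face permutation, with one transposition. This
    changes the number of faces by one; if two faces merge, the ends of the edge
    remain connected, so the Euler inequality survives in all cases. *)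

(** * Euler's inequality under edge deletion *)

Section Components.
Variable D : finType.
Implicit Types (e : rel D) (s a : {perm D}) (x y : D).

Lemma step_connect_sym e :
  (forall x y, e x y -> connect e y x) -> connect_sym e.
Proof.
move=> rev; suff sub x y : connect e x y -> connect e y x.
  by move=> x y; apply/idP/idP; apply: sub.
move=> /connectP[p]; elim: p x => [|z p IH] x /=; first by move=> _ ->.
by case/andP=> /rev ezx zp yE; apply: connect_trans ezx; apply: IH.
Qed.

Lemma n_comp_sub e e' : connect_sym e -> connect_sym e' ->
  subrel (connect e) (connect e') -> n_comp e' predT <= n_comp e predT.
Proof.
move=> sym sym' sub; set R := [set x | roots e x].
have <- : #|R| = n_comp e predT by apply: eq_card => x; rewrite !inE andbT.
apply: leq_trans (leq_imset_card (root e') R); apply: subset_leq_card.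
apply/subsetP => x; rewrite !inE andbT => /eqP rx; apply/imsetP.
exists (root e x); first by rewrite inE roots_root.
by rewrite -{1}rx; apply/(rootP sym')/sub/connect_root.
Qed.

(** Two [e']-classes that [e] joins are those of [x] and [y]. With the root of [x] set aside,
    [root e] is therefore injective on the remaining roots of [e']. *)
Lemma n_comp_cut e e' x y : connect_sym e -> connect_sym e' ->
    (forall u v, connect e u v -> [|| connect e' u v,
        connect e' u x && connect e' y v | connect e' u y && connect e' x v]) ->
  n_comp e' predT <= (n_comp e predT).+1.
Proof.
move=> sym sym' split; set R := [set u | roots e' u].
have <- : #|R| = n_comp e' predT by apply: eq_card => u; rewrite !inE andbT.
rewrite (cardsD1 (root e' x)) -(addn1 (n_comp _ _)) addnC.
apply: leq_add; last exact: leq_b1.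
rewrite -(card_in_imset (f := root e)).
  by apply/subset_leq_card/subsetP => _ /imsetP[u _ ->]; rewrite !inE roots_root.
move=> u v; rewrite !inE => /andP[ux /eqP ru] /andP[vx /eqP rv].
move/(rootP sym)/split.
case/or3P=> [/(rootP sym')||]; first by rewrite ru rv.
  by case/andP=> /(rootP sym') uX; rewrite -uX ru eqxx in ux.
by case/andP=> _ /(rootP sym') uX; rewrite uX rv eqxx in vx.
Qed.

Lemma eq_n_comp_in e e' (B : {pred D}) :
  (forall x, x \in B -> connect e x =1 connect e' x) ->
  n_comp e B = n_comp e' B.
Proof.
move=> eqB; apply: eq_card => x; rewrite !inE; case xB: (x \in B); last by rewrite !andbF.
by rewrite /roots /root (eq_pick (eqB x xB)).
Qed.

Lemma porbit_fconnect s x y : (y \in porbit s x) = fconnect s x y.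
Proof.
apply/porbitP/idP => [[i ->]|/iter_findex <-]; first by rewrite permX fconnect_iter.
by exists (findex s x y); rewrite permX.
Qed.

(** Translates face counts into [porbits], for which the effect of a transposition is known. *)
Lemma card_porbits s : #|porbits s| = fcard s predT.
Proof.
have sym := fconnect_sym (@perm_inj _ s).
rewrite /n_comp_mem -(card_in_imset (f := porbit s)).
  apply: eq_card => A; apply/imsetP/imsetP => -[x xP ->]; last by exists x.
  exists (froot s x); first by rewrite !inE roots_root.
  by apply/eqP; rewrite eq_porbit_mem porbit_fconnect sym connect_root.
move=> x y; rewrite !inE !andbT => /eqP rx /eqP ry /eqP.
by rewrite eq_porbit_mem porbit_fconnect => /(rootP sym); rewrite rx ry.
Qed.

(** The transposition splits a cycle through both points and joins two cycles otherwise; the doubled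
    truth value records both cases without subtraction. *)
Lemma porbits_tperm s x y : x != y ->
  #|porbits (tperm x y * s)%g| + (~~ fconnect s y x).*2 = #|porbits s|.+1.
Proof. by move=> xy; rewrite -porbit_fconnect porbits_mul_tperm xy addn1. Qed.

Definition perm_link s a : rel D := fun x y => (y == s x) || (y == a x).

Lemma perm_link_sym s a : connect_sym (perm_link s a).
Proof.
have sub (p : {perm D}) x :
    (forall y, perm_link s a y (p y)) -> connect (perm_link s a) (p x) x.
  move=> pl; have : fconnect p (p x) x by rewrite (fconnect_sym (@perm_inj _ p)) fconnect1.
  by apply: connect_sub => u v /eqP <-; apply: connect1.
apply: step_connect_sym => x y /orP[] /eqP ->; apply: sub => z;
  by rewrite /perm_link eqxx ?orbT.
Qed.

(* Twice Euler's inequality #edges + 2 #components <= #vertices + #faces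
   for the map with vertex rotation [s] and edge involution [a]; the points
   fixed by [a] are the darts of deleted edges. *)
Definition euler_le s a : Prop :=
  4 * n_comp (perm_link s a) predT + #|[set x | a x != x]|
    <= 2 * fcard s predT + 2 * fcard (a * s)%g predT.

(** The edge takes two darts with it, and the number of faces changes by one. A gained face pays for
    a possible new component; when two faces merge, no component is gained. *)
Lemma euler_le_cut s a d : involutive a -> a d != d ->
  euler_le s a -> euler_le s (tperm d (a d) * a)%g.
Proof.
move=> aK ad; rewrite /euler_le -!card_porbits -mulgA.
set e := a d in ad *; set t := tperm d e.
have ae : a e = d by rewrite /e aK.
pose a' := (t * a)%g.
have a'E x : a' x = if (x == d) || (x == e) then x else a x.
  rewrite permM /t; case: tpermP => [->|->|/eqP/negPf -> /eqP/negPf -> //].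
  - by rewrite eqxx.
  - by rewrite eqxx orbT.
have supp : #|[set x | a x != x]| = #|[set x | a' x != x]| + 2.
  rewrite [in LHS](cardsD1 d) [in LHS](cardsD1 e) !inE ad ae [d == e]eq_sym ad /=.
  rewrite !add1n addn2; congr _.+2.
  by apply: eq_card => x; rewrite !inE a'E; case: (x == d); case: (x == e); rewrite //= eqxx.
have := porbits_tperm (a * s)%g (x := d) (y := e); rewrite eq_sym => /(_ ad).
(* Since [t * t = 1], this instance shows that two faces merge exactly when the new face permutation
   has [d] and [e] in one cycle. *)
have := porbits_tperm (t * (a * s))%g (x := d) (y := e); rewrite eq_sym => /(_ ad).
rewrite -/t; have -> : (t * (t * (a * s)) = a * s)%g by rewrite mulgA /t tperm2 mul1g.
have symL := perm_link_sym s a; have symL' := perm_link_sym s a'.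
have le1 : n_comp (perm_link s a') predT <= (n_comp (perm_link s a) predT).+1.
  apply: (n_comp_cut (x := d) (y := e)) => // u v /connectP[p].
  elim: p u => [|w p IH] u /=; first by move=> _ ->; rewrite connect0.
  case/andP=> uw wp vE; have {IH wp vE} := IH w wp vE.
  have [cuw|nuw] := boolP (connect (perm_link s a') u w).
    case/or3P=> [H|/andP[H1 H2]|/andP[H1 H2]].
    - by rewrite (connect_trans cuw H).
    - by rewrite (connect_trans cuw H1) H2 orbT.
    - by rewrite (connect_trans cuw H1) H2 !orbT.
  have : (u == d) && (w == e) || (u == e) && (w == d).
    apply: contraR nuw; case/orP: uw => /eqP ->.
      by move=> _; apply/connect1; rewrite /perm_link eqxx.
    case: (u =P d) => [->|/eqP ud]; first by rewrite eqxx.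
    case: (u =P e) => [->|/eqP ue]; first by rewrite ae eqxx orbT.
    by move=> _; apply/connect1; rewrite /perm_link a'E (negPf ud) (negPf ue) eqxx orbT.
  case/orP=> /andP[/eqP-> /eqP->]; case/or3P=> [->|/andP[H1 ->]|/andP[H1 ->]];
    by rewrite ?connect0 ?orbT.
case: (boolP (fconnect (t * (a * s))%g e d)) => [ed|_] /=; last first.
  move: le1 supp; rewrite -/a'.
  move: (n_comp _ _) (n_comp _ _) #|_| #|_| #|_| #|_| #|_| => ? ? ? ? ? ? ?.
  by case: (fconnect _ e d) => /=; lia.
(* Faces merge: the walk from [e] to [d] along the new face uses surviving links only. *)
have ed' : connect (perm_link s a') e d.
  move: ed; rewrite mulgA -/a'; apply: connect_sub => u v /eqP <-.
  rewrite permM; apply: (connect_trans (y := a' u)); apply: connect1;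
    by rewrite /perm_link eqxx ?orbT.
have le0 : n_comp (perm_link s a') predT <= n_comp (perm_link s a) predT.
  apply: n_comp_sub => //; apply: connect_sub => u v /orP[] /eqP ->.
    by apply/connect1; rewrite /perm_link eqxx.
  case: (u =P d) => [->|/eqP ud]; first by rewrite symL'.
  case: (u =P e) => [->|/eqP ue]; first by rewrite ae.
  by apply/connect1; rewrite /perm_link a'E (negPf ud) (negPf ue) eqxx orbT.
move: le0 supp; rewrite -/a'.
move: (n_comp _ _) (n_comp _ _) #|_| #|_| #|_| #|_| #|_| => ? ? ? ? ? ? ?.
by case: (fconnect _ e d) => /=; lia.
Qed.

Lemma euler_le_sub s (a b : {perm D}) : involutive a -> involutive b ->
    (forall x, b x = a x \/ b x = x) ->
  euler_le s a -> euler_le s b.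
Proof.
move=> aK bK; move: {2}#|_| (leqnn #|[set x | b x != a x]|) => n.
elim: n a aK => [|n IH] a aK le_n bE ea.
  suff -> : b = a by [].
  apply/permP => x; move: le_n; rewrite leqn0 cards_eq0 => /eqP/setP/(_ x).
  by rewrite !inE => /negbFE/eqP.
case: (set_0Vmem [set x | b x != a x]) => [E0|[d]].
  by apply: IH ea => //; rewrite E0 cards0.
rewrite inE => nd; have bd : b d = d by case: (bE d) => // E; rewrite E eqxx in nd.
have ad : a d != d by rewrite -{2}bd eq_sym.
have be : b (a d) = a d.
  case: (bE (a d)) => //; rewrite aK => E.
  by move: (bK (a d)); rewrite E bd => E'; rewrite -E' eqxx in ad.
set a' := (tperm d (a d) * a)%g.
have a'E x : a' x = if (x == d) || (x == a d) then x else a x.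
  rewrite permM; case: tpermP => [->|->|/eqP/negPf -> /eqP/negPf -> //].
  - by rewrite eqxx aK.
  - by rewrite eqxx orbT.
apply: (IH a').
- move=> x; rewrite [a' x]a'E; case: ifP => [xd|/norP[xd xe]]; first by rewrite a'E xd.
  have axd : a x != d by apply: contraNneq xe => <-; rewrite aK.
  by rewrite a'E (negPf axd) (inj_eq perm_inj) (negPf xd) aK.
- rewrite -ltnS (leq_trans _ le_n) //; apply: proper_card; apply/properP; split.
    apply/subsetP => x; rewrite !inE a'E; case: ifP => // /orP[]/eqP->.
      by rewrite bd eqxx.
    by rewrite be eqxx.
  by exists d; rewrite !inE // a'E eqxx bd eqxx.
- move=> x; rewrite a'E; case: ifP => // /orP[]/eqP-> ; [by left|by left].
- exact: euler_le_cut.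
Qed.

End Components.

(** * Faces and edge density *)

Lemma connect_sub_in (D : finType) (e e' : rel D) (B : {pred D}) :
    (forall x y, x \in B -> e x y -> y \in B /\ connect e' x y) ->
  forall x y, x \in B -> connect e x y -> connect e' x y.
Proof.
move=> sub x y xB /connectP[p]; elim: p x xB => [|z p IH] x xB /=.
  by move=> _ ->; apply: connect0.
by case/andP=> /(sub _ _ xB)[zB xz] zp yE; apply: connect_trans xz (IH z zB zp yE).
Qed.

(** A repeated vertex cuts off a shorter closed walk; without repetition the walk is a cycle,
    lengths 1 and 2 being excluded by irreflexivity and non-backtracking. Indexing by all of [nat]
    makes the shorter walk a shift of [v], so that no condition at the closing vertex arises. *)
Lemma girth_walk (T : finType) (G : sgraph T) g (v : nat -> T) n :
    girth_ge G g -> (forall i, adj G (v i) (v i.+1)) ->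
    (forall i, v i.+2 != v i) -> 0 < n -> v n = v 0 ->
  g <= n.
Proof.
move=> girth; move: {2}n (leqnn n) => m; elim: m v n => [|m IH] v n le_nm adjv nb n0 vn.
  by lia.
have [un|/(uniqPn (v 0))[i [j [ij jn]]]] := boolP (uniq (mkseq v n)).
  have := girth _ un; rewrite size_mkseq; apply.
    case: n n0 vn {le_nm un} => [|[|[|n]]] // _ vn.
      by have := adjv 0; rewrite vn adj_irr.
    by have := nb 0; rewrite vn eqxx.
  case: n n0 vn {le_nm un} => // n _ vn.
  have step k l : path (adj G) (v k) [seq v i | i <- iota k.+1 l].
    by elim: l k => //= l IHl k; rewrite adjv IHl.
  by have := step 0 (n + 1); rewrite iotaD map_cat cats1 add1n vn.
rewrite size_mkseq in jn; rewrite !nth_mkseq ?(ltn_trans ij) // => vij.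
apply: leq_trans (_ : j - i <= n); last by lia.
apply: (IH (fun k => v (i + k))); first by lia.
- by move=> k; rewrite addnS.
- by move=> k; rewrite !addnS.
- by lia.
- by rewrite subnKC 1?ltnW // addn0.
Qed.

Section EdgeBound.
Variables (T : finType) (G : sgraph T).
Notation D := (dart G).
Implicit Types (d x y : D) (S : {set T}).

Notation tail := (@dart_tail T G).
Notation rev := (@rev_dart T G).

Lemma rev_dartK : involutive rev.
Proof. by move=> [[u v] uv]; apply: val_inj. Qed.

Lemma rev_dart_neq d : rev d != d.
Proof.
case: d => [[u v] uv]; apply/eqP => /(congr1 val) [vu _].
by move: uv; rewrite /= vu adj_irr.
Qed.

Lemma dart_eq d d' : tail d = tail d' -> tail (rev d) = tail (rev d') -> d = d'.
Proof. by case: d d' => [[u v] uv] [[u' v'] uv'] /= E1 E2; apply: val_inj; congr pair. Qed.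

Lemma dart_adj d : adj G (tail d) (tail (rev d)).
Proof. exact: valP d. Qed.

Definition deg_in S u := #|[set w in S | adj G u w]|.

Definition darts_in S := [set d | (tail d \in S) && (tail (rev d) \in S)].

Lemma card_darts_in S : #|darts_in S| = \sum_(u in S) deg_in S u.
Proof.
have -> : #|darts_in S| = #|[set p : T * T | [&& p.1 \in S, p.2 \in S & adj G p.1 p.2]]|.
  rewrite -(card_imset _ (@val_inj _ _ (dart G))); apply: eq_card => p.
  apply/imsetP/idP => [[d]|]; rewrite !inE.
    by case/andP=> uS vS ->; rewrite uS vS dart_adj.
  case/and3P=> uS vS uv; exists (exist _ p uv) => //.
  by rewrite inE uS vS.
rewrite -sum1dep_card; under [RHS]eq_bigr do rewrite /deg_in -sum1dep_card.
rewrite pair_big_dep /=; apply: eq_bigl => p; by rewrite andbA.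
Qed.

Definition restr_rev S d := if d \in darts_in S then rev d else d.

Lemma rev_darts_in S d : (rev d \in darts_in S) = (d \in darts_in S).
Proof. by rewrite !inE rev_dartK andbC. Qed.

Lemma restr_revK S : involutive (restr_rev S).
Proof.
move=> d; rewrite /restr_rev; have [dS|/negPf dS] := boolP (d \in _); last by rewrite dS.
by rewrite rev_darts_in dS rev_dartK.
Qed.

(* Darts leaving [G[S]] stay in the rotation as dangling half-edges, which a
   face walk skips. *)
Definition face_in (sigma : D -> D) S d := sigma (restr_rev S d).

(** * Face walks in the induced subgraph *)

Section Faces.
Variables (sigma : D -> D) (S : {set T}).
Hypothesis rot : rotation_system sigma.
Hypothesis deg2 : forall u, u \in S -> 1 < deg_in S u.

Lemma sigma_inj : injective sigma. Proof. by case: rot. Qed.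

Let K := darts_in S.
Let phi := face_in sigma S.

Lemma exists_dart_in u w : u \in S ->
  exists y, [/\ y \in K, tail y = u & tail (rev y) != w].
Proof.
move=> uS; have : 0 < #|[set w in S | adj G u w] :\ w|.
  by have := deg2 uS; rewrite /deg_in (cardsD1 w); case: (w \in _) => //; lia.
case/card_gt0P => z; rewrite !inE => /and3P[zw zS uz].
by exists (exist _ (u, z) uz); rewrite !inE /dart_tail /= uS zS.
Qed.

(** Outside [K] the face map only rotates, and the rotation about [tail x] meets [K]; up to the
    first meeting both maps have the same iterates. *)
Lemma face_hits x : tail x \in S -> exists2 y, y \in K & fconnect phi x y.
Proof.
move=> xS; have [y0 [y0K y0x _]] := exists_dart_in (tail x) xS.
have [_ _ orb] := rot.
have ex : exists k, iter k sigma x \in K.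
  by exists (findex sigma x y0); rewrite iter_findex ?orb.
case: (ex_minnP ex) => k kK mink; exists (iter k sigma x) => //.
suff <- : iter k phi x = iter k sigma x by apply: fconnect_iter.
elim: {1 3 4}k (leqnn k) => //= i IH ik; rewrite IH 1?ltnW // /phi /face_in /restr_rev.
by case: ifP => // /mink; rewrite leqNgt ik.
Qed.

(** Minimum degree 2 makes face walks non-backtracking: from [rev d] the rotation reaches another
    dart of [K], and the face map skips the dangling half-edges before it. *)
Lemma face_next d : d \in K ->
  exists y, [&& y \in K, fconnect phi d y, tail y == tail (rev d) & y != rev d].
Proof.
move=> dK; have rdS : tail (rev d) \in S by move: dK; rewrite inE => /andP[].
have [y0 [y0K y0d y0n]] := exists_dart_in (tail d) rdS.
have [_ tls orb] := rot.
have ex : exists k, (iter k sigma (rev d) \in K) && (iter k sigma (rev d) != rev d).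
  exists (findex sigma (rev d) y0); rewrite iter_findex ?orb // y0K.
  by apply: contraNneq y0n => ->; rewrite rev_dartK.
case: (ex_minnP ex) => k /andP[kK kd] mink.
exists (iter k sigma (rev d)); rewrite kK kd.
have -> : tail (iter k sigma (rev d)) == tail (rev d).
  by rewrite -(fconnect_invariant (k := tail) _ (fconnect_iter sigma k _)) // => z; apply/eqP.
rewrite !andbT /=.
suff <- : iter k phi d = iter k sigma (rev d) by apply: fconnect_iter.
case: k kK kd mink => [|k] kK kd mink; first by rewrite eqxx in kd.
elim: {1 3 4}k (leqnn k) => [|i IH] ik; first by rewrite /= /phi /face_in /restr_rev dK.
rewrite iterS IH 1?ltnW // /phi /face_in /restr_rev; case: ifP => // iK.
(* A return to [rev d] before the chosen index is impossible: cutting out the full turn would give a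
   smaller index. *)
have [E|nE] := eqVneq (iter i.+1 sigma (rev d)) (rev d); last first.
  by have := mink i.+1; rewrite iK nE => /(_ isT); lia.
have kE : iter k.+1 sigma (rev d) = iter (k - i) sigma (rev d).
  by rewrite -{2}E -iterD (_ : k - i + i.+1 = k.+1) //; lia.
by have := mink (k - i); rewrite -kE kK kd => /(_ isT); lia.
Qed.

(** Iterating [face_next] gives a non-backtracking walk inside the face; by pigeonhole it contains a
    closed walk of length at most [#|F|]. *)
Lemma face_size g d : girth_ge G g -> d \in K ->
  g <= #|[set y in K | fconnect phi d y]|.
Proof.
move=> girth dK; set F := [set y in K | _].
have memF y : (y \in F) = (y \in K) && fconnect phi d y by rewrite in_set.
pose nxt x := odflt x
  [pick y | [&& y \in K, fconnect phi x y, tail y == tail (rev x) & y != rev x]].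
have nxtP x : x \in K -> [/\ nxt x \in K, fconnect phi x (nxt x),
    tail (nxt x) = tail (rev x) & nxt x != rev x].
  move=> xK; rewrite /nxt; case: pickP => [y /and4P[? ? /eqP ? ?] //|none].
  by have [y] := face_next xK; rewrite none.
have itF i : iter i nxt d \in F.
  elim: i => [|i]; rewrite memF ?dK ?connect0 // memF iterS => /andP[iK ic].
  by have [-> nc _ _] := nxtP _ iK; apply: connect_trans nc.
have itK i : iter i nxt d \in K by move: (itF i); rewrite memF => /andP[].
have : looping nxt d #|F|.
  rewrite -[looping _ _ _]negbK -looping_uniq; apply/negP => /card_uniqP.
  rewrite size_traject => E.
  have /subset_leq_card : traject nxt d #|F|.+1 \subset F.
    by apply/subsetP => y /trajectP[i _ ->]; apply: itF.
  by rewrite E ltnn.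
case/trajectP => i iF E; apply: leq_trans (leq_subr i _).
have [_ _ _] := nxtP _ (itK 0) => _.
apply: (girth_walk (v := fun k => tail (iter (i + k) nxt d)) girth).
- move=> k; rewrite addnS iterS; have [_ _ -> _] := nxtP _ (itK (i + k)); exact: dart_adj.
- move=> k; rewrite !addnS 2!iterS; set x := iter _ _ _.
  have xK : x \in K := itK _; have [nK _ nt nr] := nxtP _ xK.
  have [_ _ -> _] := nxtP _ nK; apply: contraNneq nr => E'.
  by apply/eqP/dart_eq; rewrite ?rev_dartK.
- by rewrite subn_gt0.
- by rewrite subnKC 1?ltnW // addn0 E.
Qed.

End Faces.

(** * The Euler count for the induced subgraph *)

Lemma euler_arith v e f c :
  v + e + f = 2 * c + e * 2 -> 4 * c + e * 2 <= 2 * v + 2 * f.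
Proof. lia. Qed.

(** Here [m] counts the rotation orbits outside [S]; each is also a face and a component, so [4 * m]
    cancels. With [c >= 1] this leaves [4 + k <= 2 * n + 2 * f], and [8 * f <= k] eliminates [f]. *)
Lemma face_arith c v f k n m : 0 < c -> v <= n -> f * 8 <= k ->
  4 * (c + m) + k <= 2 * (v + m) + 2 * (f + m) -> 3 * k + 16 <= 8 * n.
Proof. lia. Qed.

Lemma planar_edge_bound S : planar G -> girth_ge G 8 -> S != set0 ->
    (forall u, u \in S -> 1 < deg_in S u) ->
  3 * (\sum_(u in S) deg_in S u) + 16 <= 8 * #|S|.
Proof.
move=> [sigma [rot genus]] girth S0 deg2; rewrite -card_darts_in.
have sigmaI := sigma_inj rot; have [_ tls orb] := rot.
pose s := perm sigmaI; pose r := perm (inv_inj rev_dartK).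
pose b := perm (inv_inj (@restr_revK S)).
set K := darts_in S.
have sE d : s d = sigma d by rewrite permE.
have bE d : b d = restr_rev S d by rewrite permE.
have phiE : (b * s)%g =1 face_in sigma S by move=> d; rewrite permM !permE.
have euler : euler_le s b.
  apply: (@euler_le_sub _ s r).
  - by move=> d; rewrite !permE rev_dartK.
  - by move=> d; rewrite !permE restr_revK.
  - by move=> d; rewrite !permE /restr_rev; case: ifP; [left|right].
  rewrite /euler_le (eq_fcard sE) (@eq_fcard _ (r * s)%g (face_perm sigma)); last first.
    by move=> d; rewrite permM !permE.
  (* [genus0] counts components of an already transitive closure; closing again changes nothing. *)
  have -> : n_comp (perm_link s r) predT = n_comp (connect (map_link sigma)) predT.
    apply: eq_n_comp => x y; have -> : connect (perm_link s r) =2 connect (map_link sigma).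
      by apply: eq_connect => u v; rewrite /perm_link /map_link !permE.
    apply/idP/idP; first by apply/connect_sub => u v uv; do 2!apply: connect1.
    exact: connect_sub.
  have supp : [set x | r x != x] = setT.
    by apply/setP => d; rewrite !inE permE rev_dart_neq.
  have edges : fcard rev predT * 2 = #|(predT : {pred D})|.
    apply: (fcard_order_set (inv_inj rev_dartK)); last by [].
    apply/subsetP => d _; rewrite inE.
    rewrite (order_cycle (p := [:: d; rev d])) //= ?inE ?eqxx ?rev_dartK ?eqxx //.
    by rewrite eq_sym rev_dart_neq.
  have -> : #|[set x | r x != x]| = #|(predT : {pred D})|.
    by rewrite supp; apply: eq_card => d; rewrite inE.
  move: genus; rewrite /genus0 -edges.
  exact: euler_arith.
(* Darts based outside [S] are fixed by [b], so on [B] rotation orbits, faces and components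
   coincide. *)
pose A := [pred d : D | tail d \in S]; pose B := [predC A].
have Bb x : x \in B -> b x = x.
  by rewrite !inE bE /restr_rev inE => /negPf ->.
have As x : (s x \in A) = (x \in A) by rewrite !inE sE tls.
have Ab x : (b x \in A) = (x \in A).
  by rewrite !inE bE /restr_rev inE; case: ifP => // /andP[-> ->].
have Bs x : (s x \in B) = (x \in B) by rewrite inE /= As.
have LB : n_comp (perm_link s b) B = fcard s B.
  apply: eq_n_comp_in => x xB y; apply/idP/idP.
    apply: (connect_sub_in (B := B)) xB => u v uB /orP[] /eqP ->.
      by rewrite Bs uB fconnect1.
    by rewrite Bb // uB connect0.
  by apply: connect_sub => u v /eqP <-; apply: connect1; rewrite /perm_link eqxx.
have fB x : x \in B -> (b * s)%g x = s x by move=> xB; rewrite permM Bb.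
have PB : fcard (b * s)%g B = fcard s B.
  apply: eq_n_comp_in => x xB y; apply/idP/idP.
    apply: (connect_sub_in (B := B)) xB => u v uB /eqP; rewrite (fB u uB) => <-.
    by split; [rewrite Bs|apply: fconnect1].
  apply: (connect_sub_in (B := B)) xB => u v uB /eqP <-.
  by split; [rewrite Bs|rewrite -(fB u uB); apply: fconnect1].
have LA : 0 < n_comp (perm_link s b) A.
  have /set0Pn[u uS] := S0; have [d [dK du _]] := exists_dart_in deg2 u uS.
  have clA : closed (perm_link s b) A by move=> x y /orP[] /eqP ->; rewrite ?As ?Ab.
  have rA : root (perm_link s b) d \in A.
    by rewrite -(closed_connect clA (connect_root _ d)) inE du.
  apply/card_gt0P; exists (root (perm_link s b) d); apply/andP; split; last exact: rA.
  by apply: roots_root; apply: perm_link_sym.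
have SA : fcard s A <= #|S|.
  rewrite /n_comp_mem -(card_in_imset (f := tail)).
    by apply/subset_leq_card/subsetP => _ /imsetP[x /andP[_ xA] ->].
  move=> x y /andP[/eqP rx _] /andP[/eqP ry _] /orb.
  rewrite -(eq_fconnect sE) => /(rootP (fconnect_sym (@perm_inj _ s))).
  by rewrite rx ry.
(* The darts of [K] are sorted by face; each face based in [S] meets [K] and so holds at least 8 of
   them. *)
have FA : fcard (b * s)%g A * 8 <= #|K|.
  have sym := fconnect_sym (@perm_inj _ (b * s)%g); set f := (b * s)%g in sym *.
  have clA : closed (frel f) A by move=> x y /eqP <-; rewrite permM As Ab.
  rewrite -sum1_card (partition_big (froot f) [predI froots f & A]) /=; last first.
    move=> d dK; apply/andP; split; first exact: roots_root.
    have dA : d \in A by move: dK; rewrite !inE => /andP[].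
    by have := closed_connect clA (connect_root (frel f) d); rewrite dA => <-.
  rewrite -sum_nat_const; apply: leq_sum => d /andP[/eqP rd dA].
  have [y yK dy] := face_hits rot deg2 dA.
  rewrite -(eq_fconnect phiE) -/f in dy.
  apply: leq_trans (face_size rot deg2 girth yK) _.
  rewrite sum1dep_card; apply/subset_leq_card/subsetP => z; rewrite !inE => /andP[-> /=].
  rewrite -(eq_fconnect phiE) -/f => yz.
  by have /(rootP sym) := connect_trans dy yz; rewrite rd => <-.
move: euler; rewrite /euler_le !(n_compC A) LB PB.
have -> : [set x | b x != x] = K.
  apply/setP => d; rewrite in_set bE /restr_rev /K.
  by case: (d \in darts_in S); rewrite ?rev_dart_neq ?eqxx.
move: LA SA FA; exact: face_arith.
Qed.

End EdgeBound.

(** * Discharging *)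

Lemma card_bigcup_le (I D : finType) (A : {set I}) (F : I -> {set D}) k :
  (forall i, i \in A -> #|F i| <= k) -> #|\bigcup_(i in A) F i| <= k * #|A|.
Proof.
move=> Fk; rewrite mulnC -sum_nat_const.
apply: (@leq_trans (\sum_(i in A) #|F i|)); last exact: leq_sum.
elim/big_rec2: _ => [|i m B _ le]; first by rewrite cards0.
by apply: leq_trans (leq_card_setU _ _) _; rewrite leq_add2l.
Qed.

Section Light.
Variables (T : finType) (G : sgraph T).
Implicit Types (S : {set T}) (u v w : T).

Definition light S v := [set u in S | adj G v u && (deg_in G S u <= 2)].
Definition heavy S v := [set u in S | adj G v u && (2 < deg_in G S u)].

Lemma deg_in_split S v : deg_in G S v = #|heavy S v| + #|light S v|.
Proof.
rewrite /deg_in -(cardsID [set u | deg_in G S u <= 2]) addnC.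
by congr addn; apply: eq_card => u; rewrite !inE ?ltnNge;
  case: (u \in S); case: (adj G v u); rewrite /= ?andbT ?andbF.
Qed.

(** Charges are tripled degrees, and each vertex gives 1 to each light neighbor. Without a reducible
    vertex everyone ends with at least 8, against [planar_edge_bound]. *)
Lemma exists_reducible S : planar G -> girth_ge G 8 -> S != set0 ->
  exists2 v, v \in S & 3 * #|heavy S v| + #|light S v| < 6.
Proof.
move=> pl girth S0; apply/exists_inP; apply: contraT; rewrite negb_exists_in.
move/forall_inP=> irr.
have ge6 v : v \in S -> 6 <= 3 * #|heavy S v| + #|light S v|.
  by move=> vS; rewrite leqNgt irr.
have deg2 v : v \in S -> 1 < deg_in G S v.
  by move=> /ge6; rewrite deg_in_split; lia.
(* Double counting: each vertex of degree 2 is a light neighbor of exactly two vertices. *)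
have lights : \sum_(v in S) #|light S v| = \sum_(v in S) 2 * (deg_in G S v == 2).
  under eq_bigr => v _ do rewrite /light -sum1dep_card big_mkcondr /=.
  rewrite exchange_big /=; apply: eq_bigr => u uS.
  case: eqP (deg2 u uS) => [d2 _|nd2 d1]; last first.
    by apply: big1 => v _; case: ifP => // /andP[_]; lia.
  transitivity (deg_in G S u); last by rewrite d2.
  rewrite [RHS]/deg_in -[RHS]sum1dep_card [RHS]big_mkcondr /=.
  by apply: eq_bigr => v _; rewrite d2 andbT adj_sym.
have := planar_edge_bound pl girth S0 deg2.
(* Let [h] and [l] count heavy and light neighbors, so [3 * h + l >= 6]. Degree 2 forces [h = 2],
   [l = 0] and final charge exactly 8; otherwise [h + l >= 3] and the claim is
   [3 * h + 2 * l >= 8]. *)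
have : \sum_(v in S) (8 + #|light S v|)
    <= \sum_(v in S) (3 * deg_in G S v + 2 * (deg_in G S v == 2)).
  apply: leq_sum => v /ge6; rewrite deg_in_split.
  by case: eqP; lia.
rewrite big_split [X in _ <= X]big_split /= lights sum_nat_const -!big_distrr /=.
move: (\sum_(v in S) deg_in G S v) (\sum_(v in S) _) #|S| => ? ? ?; lia.
Qed.

End Light.

(** * Extending pairs of disjoint colorings *)

Section Coloring.
Variables (T : finType) (G : sgraph T) (HT : finType) (H : sgraph HT).
Variable L : T -> {set HT}.
Hypotheses (cover : corr_cover G H L) (fold3 : k_fold L 3).
Implicit Types (S : {set T}) (u v w : T) (p q r : HT * HT) (f : T -> HT * HT).

Definition color_pair u p := [&& p.1 \in L u, p.2 \in L u & p.1 != p.2].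
Definition compatible p q := ~~ adj H p.1 q.1 && ~~ adj H p.2 q.2.

Definition disjoint_colorings S f :=
  (forall u, u \in S -> color_pair u (f u)) /\
  (forall u w, u \in S -> w \in S -> adj G u w -> compatible (f u) (f w)).

Lemma compatibleC p q : compatible p q = compatible q p.
Proof. by rewrite /compatible ![adj H p.1 _]adj_sym ![adj H p.2 _]adj_sym. Qed.

Lemma matching u w x y y' : adj G u w -> x \in L u -> y \in L w -> y' \in L w ->
  adj H x y -> adj H x y' -> y = y'.
Proof.
case: cover => _ _ _ _ m uw xu yw y'w xy xy'.
by have /card_le1_eqP := m _ _ uw x xu; apply; rewrite inE ?yw ?y'w.
Qed.

Lemma exists_other u x : exists2 y, y \in L u & y != x.
Proof.
have : 0 < #|L u :\ x| by have := fold3 u; rewrite (cardsD1 x); case: (x \in _) => /=; lia.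
by case/card_gt0P => y; rewrite !inE => /andP[]; exists y.
Qed.

Lemma L_third u x y : x \in L u -> y \in L u -> x != y ->
  exists z, [/\ z \in L u, z != x, z != y &
    forall t, t \in L u -> [|| t == x, t == y | t == z]].
Proof.
move=> xu yu xy; have := fold3 u.
rewrite (cardsD1 x) (cardsD1 y) xu !inE yu eq_sym xy /= => -[/eqP/cards1P[z zE]].
have : z \in L u :\ x :\ y by rewrite zE set11.
rewrite !inE => /and3P[zy zx zu]; exists z; split => // t tu.
have : (t \in L u :\ x :\ y) = (t == z) by rewrite zE inE.
by rewrite !inE tu andbT => <-; case: (t == x); case: (t == y).
Qed.

Lemma card_color_pair u : #|[set p | color_pair u p]| = 6.
Proof.
rewrite -sum1dep_card.
rewrite (eq_bigl (fun p => (p.1 \in L u) && (p.2 \in L u :\ p.1))); last first.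
  by move=> p; rewrite !inE /color_pair eq_sym [(_ != _) && _]andbC.
rewrite -(pair_big_dep (mem (L u)) (fun x y => y \in L u :\ x) (fun _ _ => 1)) /=.
rewrite (eq_bigr (fun=> 2)) => [|x xu]; first by rewrite sum_nat_const fold3.
by rewrite sum1_card; have := fold3 u; rewrite (cardsD1 x) xu => -[].
Qed.

(** A bad pair has first color [x] or second color [y]. As [x != y], only [(x, y)], [(x, z)] and
    [(z, y)] qualify; with [x = y] there would be four. *)
Lemma card_heavy_bad v w q : adj G v w -> color_pair w q ->
  #|[set p | color_pair v p && ~~ compatible p q]| <= 3.
Proof.
move=> vw /and3P[q1 q2 q12]; have wv : adj G w v by rewrite adj_sym.
(* The colors matched to [q.1] and [q.2]. They differ, since a color has at most one neighbor in
   [L w]; a missing one is replaced by any color that keeps them distinct. *)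
have [x [y [xv yv xy x1 y2]]] : exists x y, [/\ x \in L v, y \in L v, x != y,
    forall t, t \in L v -> adj H t q.1 -> t = x &
    forall t, t \in L v -> adj H t q.2 -> t = y].
  have uniq1 c t t' : c \in L w -> t \in L v -> t' \in L v ->
      adj H t c -> adj H t' c -> t = t'.
    by rewrite ![adj H _ c]adj_sym => *; apply: (matching wv (x := c)).
  have [x /andP[xv xq]|no1] := pickP [pred x in L v | adj H x q.1];
  have [y /andP[yv yq]|no2] := pickP [pred x in L v | adj H x q.2].
  - exists x, y; split => //.
    + by apply: contraNneq q12 => xy; apply/eqP/(matching vw xv) => //; rewrite xy.
    + by move=> t tv tq; apply: uniq1 tq xq.
    + by move=> t tv tq; apply: uniq1 tq yq.
  - have [y yv yx] := exists_other v x; exists x, y; split; rewrite // 1?eq_sym //.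
    + by move=> t tv tq; apply: uniq1 tq xq.
    + by move=> t tv tq; have := no2 t; rewrite /= tv tq.
  - have [x xv xy] := exists_other v y; exists x, y; split => //.
    + by move=> t tv tq; have := no1 t; rewrite /= tv tq.
    + by move=> t tv tq; apply: uniq1 tq yq.
  - have [x xv _] := exists_other v q.1; have [y yv yx] := exists_other v x.
    exists x, y; split; rewrite // 1?eq_sym //.
    + by move=> t tv tq; have := no1 t; rewrite /= tv tq.
    + by move=> t tv tq; have := no2 t; rewrite /= tv tq.
have [z [zv zx zy Lv]] := L_third xv yv xy.
apply: leq_trans (card_size [:: (x, y); (x, z); (z, y)]).
apply/subset_leq_card/subsetP => -[p1 p2]; rewrite !inE /compatible /= -/(compatible _ _).
case/andP=> /and3P[/= p1v p2v p12]; rewrite negb_and !negbK !xpair_eqE.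
case/orP=> [/(x1 _ p1v) E|/(y2 _ p2v) E]; subst.
  by case/or3P: (Lv _ p2v) p12 => /eqP ->; rewrite ?eqxx ?orbT.
by case/or3P: (Lv _ p1v) p12 => /eqP ->; rewrite ?eqxx ?orbT.
Qed.

Lemma extend_one u v p : adj G u v -> color_pair v p ->
  exists r, color_pair u r && compatible r p.
Proof.
move=> uv pv; have : 0 < #|[set r | color_pair u r] :\: [set r | color_pair u r && ~~ compatible r p]|.
  rewrite cardsD card_color_pair subn_gt0.
  apply: leq_ltn_trans (subset_leq_card (subsetIr _ _)) _.
  by apply: leq_ltn_trans (card_heavy_bad uv pv) _.
case/card_gt0P => r; rewrite !inE => /andP[nr ru]; exists r.
by move: nr; rewrite ru /= negbK.
Qed.

(** In each coordinate the two neighbors exclude at most two of three colors, so some color is free;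
    being stuck forces one color [c] to be the only free one in both. The other two colors are then
    excluded in both coordinates. A neighbor excludes at most one color per coordinate, and never
    the same color in both, so [v] and [w] exchange roles between the coordinates. *)
Lemma stuck_swap v u w p q : adj G v u -> adj G u w ->
    color_pair v p -> color_pair w q ->
    ~~ [exists r, [&& color_pair u r, compatible r p & compatible r q]] ->
  (exists a, [/\ a \in L u, adj H a p.1 & adj H a q.2]) /\
  (exists a, [/\ a \in L u, adj H a p.2 & adj H a q.1]).
Proof.
move=> vu uw /and3P[p1 p2 p12] /and3P[q1 q2 q12] /existsPn stuck.
have uv : adj G u v by rewrite adj_sym.
have wu : adj G w u by rewrite adj_sym.
have uniqp t x x' : t \in L v -> x \in L u -> x' \in L u ->
    adj H x t -> adj H x' t -> x = x'.
  by rewrite ![adj H _ t]adj_sym => *; apply: (matching vu (x := t)).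
have uniqq t x x' : t \in L w -> x \in L u -> x' \in L u ->
    adj H x t -> adj H x' t -> x = x'.
  by rewrite ![adj H _ t]adj_sym => *; apply: (matching wu (x := t)).
have free t t' : t \in L v -> t' \in L w ->
    exists2 c, c \in L u & ~~ adj H c t && ~~ adj H c t'.
  move=> tv tw; apply/exists_inP; apply: contraT => /exists_inPn none.
  have [x xu _] := exists_other u t; have [y yu yx] := exists_other u x.
  have [z [zu zx zy _]] := L_third yu xu yx.
  have N c : c \in L u -> adj H c t || adj H c t'.
    by move=> /none; rewrite negb_and !negbK.
  have P c c' := @uniqp t c c' tv; have Q c c' := @uniqq t' c c' tw.
  case/orP: (N x xu) (N y yu) (N z zu) => ax /orP[] ay /orP[] az;
    by move: yx zx zy; rewrite ?(P _ _ xu yu ax ay) ?(P _ _ xu zu ax az)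
      ?(P _ _ yu zu ay az) ?(Q _ _ xu yu ax ay) ?(Q _ _ xu zu ax az)
      ?(Q _ _ yu zu ay az) ?eqxx.
have [c cu /andP[cp1 cq1]] := free _ _ p1 q1.
have [c' c'u /andP[cp2 cq2]] := free _ _ p2 q2.
have same d d' : d \in L u -> d' \in L u -> ~~ adj H d p.1 -> ~~ adj H d q.1 ->
    ~~ adj H d' p.2 -> ~~ adj H d' q.2 -> d = d'.
  move=> du d'u n1 n2 n3 n4; have := stuck (d, d').
  by rewrite /color_pair /compatible /= du d'u n1 n2 n3 n4 /= andbT negbK => /eqP.
have cc' := same _ _ cu c'u cp1 cq1 cp2 cq2; subst c'.
have A1 d : d \in L u -> d != c -> adj H d p.1 || adj H d q.1.
  move=> du; apply: contraR; rewrite negb_or => /andP[n1 n2].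
  by rewrite (same _ _ du cu n1 n2 cp2 cq2).
have A2 d : d \in L u -> d != c -> adj H d p.2 || adj H d q.2.
  move=> du; apply: contraR; rewrite negb_or => /andP[n1 n2].
  by rewrite (same _ _ cu du cp1 cq1 n1 n2).
have [x xu xc] := exists_other u c; have [y [yu yx yc _]] := L_third xu cu xc.
have Nv d : d \in L u -> adj H d p.1 -> adj H d p.2 = false.
  move=> du n1; apply: contraNF p12 => n2; exact/eqP/(matching uv du).
have Nw d : d \in L u -> adj H d q.1 -> adj H d q.2 = false.
  move=> du n1; apply: contraNF q12 => n2; exact/eqP/(matching uw du).
have U1 : adj H x p.1 -> adj H y p.1 -> False.
  by move=> a1 a2; rewrite (uniqp _ _ _ p1 xu yu a1 a2) eqxx in yx.
have U2 : adj H x q.1 -> adj H y q.1 -> False.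
  by move=> a1 a2; rewrite (uniqq _ _ _ q1 xu yu a1 a2) eqxx in yx.
case/orP: (A1 x xu xc) (A1 y yu yc) (A2 x xu xc) (A2 y yu yc) => ax /orP[] ay;
  [by case: U1| | |by case: U2].
  rewrite (Nv x) // (Nw y) //= orbF => b1 b2.
  by split; [exists x|exists y].
rewrite (Nw x) // (Nv y) //= orbF => b1 b2.
by split; [exists y|exists x].
Qed.

(** The swap determines [p]: [q.2] fixes its match [a] in [L u], which fixes [p.1]; likewise [q.1]
    fixes [p.2]. *)
Lemma card_light_bad v u w q : adj G v u -> adj G u w -> color_pair w q ->
  #|[set p | color_pair v p &&
     ~~ [exists r, [&& color_pair u r, compatible r p & compatible r q]]]| <= 1.
Proof.
move=> vu uw qw; have wu : adj G w u by rewrite adj_sym.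
have uv : adj G u v by rewrite adj_sym.
have /and3P[q1 q2 _] := qw.
apply/card_le1_eqP => p p'; rewrite !inE => /andP[pv st] /andP[pv' st'].
have [[a [au ap aq]] [b [bu bp bq]]] := stuck_swap vu uw pv qw st.
have [[a' [au' ap' aq']] [b' [bu' bp' bq']]] := stuck_swap vu uw pv' qw st'.
move: pv pv' => /and3P[p1 p2 _] /and3P[p1' p2' _].
have aa' : a = a' by apply: (matching wu q2 au au'); rewrite adj_sym.
have bb' : b = b' by apply: (matching wu q1 bu bu'); rewrite adj_sym.
subst a' b'; move: (matching uv au p1 p1' ap ap') (matching uv bu p2 p2' bp bp').
by case: (p) (p') => [? ?] [? ?] /= -> ->.
Qed.

(** * Extension over a reducible vertex *)

Section Extension.
Variables (S : {set T}) (v : T) (f : T -> HT * HT).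
Hypotheses (vS : v \in S) (tri : girth_ge G 4).
Let S' := S :\ v :\: light G S v.
Hypothesis colf : disjoint_colorings S' f.

Definition light_ok u p r := [&& color_pair u r, compatible r p &
  [forall (w | (w \in S :\ v) && adj G u w), compatible r (f w)]].

Lemma triangle_free x y z : adj G x y -> adj G y z -> adj G x z = false.
Proof.
move=> xy yz; apply/negP => xz.
have nxy : x != y by apply: contraTneq xy => ->; rewrite adj_irr.
have nyz : y != z by apply: contraTneq yz => ->; rewrite adj_irr.
have nxz : x != z by apply: contraTneq xz => ->; rewrite adj_irr.
have := @tri [:: x; y; z]; rewrite /= !inE negb_or nxy nxz nyz xy yz [adj G z x]adj_sym xz.
by move=> /(_ isT isT isT).
Qed.

Lemma mem_rest w : w \in S -> w != v -> w \notin light G S v -> w \in S'.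
Proof. by move=> wS wv wl; rewrite !in_setD wl in_set1 wv. Qed.

(** Within [S], a light [u] has at most one neighbor [w] besides [v]. Without it [u] is never stuck;
    otherwise [w] is not light, for lack of triangles, so it is already colored and [card_light_bad]
    applies. *)
Lemma card_stuck_light u : u \in light G S v ->
  #|[set p | color_pair v p && ~~ [exists r, light_ok u p r]]| <= 1.
Proof.
rewrite inE => /and3P[uS vu d2]; have uv : adj G u v by rewrite adj_sym.
have [N0|[w wN]] := set_0Vmem [set w in S :\ v | adj G u w].
  rewrite (_ : [set p | _] = set0) ?cards0 //; apply/setP => p; rewrite !inE.
  apply/negbTE/negP => /andP[pv /existsPn none].
  have [r /andP[ru rp]] := extend_one uv pv.
  have := none r; rewrite /light_ok ru rp /= => /forall_inP[] z zP.
  by move/setP/(_ z): N0; rewrite !inE in zP *; rewrite zP.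
have Nw z : z \in S :\ v -> adj G u z -> z = w.
  have cN : #|[set w in S :\ v | adj G u w]| <= 1.
    have := d2; rewrite /deg_in (cardsD1 v) inE vS uv add1n ltnS => le1.
    by apply: leq_trans le1; apply/subset_leq_card/subsetP => t; rewrite !inE andbA.
  by move=> zS uz; apply: (card_le1_eqP cN); rewrite ?inE in zS wN *; rewrite ?zS.
move: wN; rewrite 3!inE => /andP[/andP[wv wS] uw].
have wS' : w \in S'.
  by apply: mem_rest => //; rewrite inE (triangle_free vu uw) andbF.
apply: leq_trans (card_light_bad vu uw (colf.1 w wS')).
apply/subset_leq_card/subsetP => p; rewrite !inE => /andP[-> /existsPn none] /=.
apply/existsPn => r; apply: contra (none r) => /and3P[ru rp rq].
rewrite /light_ok ru rp; apply/forall_inP => z /andP[zS uz].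
by rewrite (Nw z zS uz).
Qed.

(** Fewer than six pairs are excluded at [v]. Once [v] has a remaining pair, its light neighbors are
    colored independently: two adjacent ones would form a triangle with [v]. *)
Lemma extend_coloring : 3 * #|heavy G S v| + #|light G S v| < 6 ->
  exists f', disjoint_colorings S f'.
Proof.
move=> lt6.
pose X := \bigcup_(w in heavy G S v) [set p | color_pair v p && ~~ compatible p (f w)].
pose Y := \bigcup_(u in light G S v) [set p | color_pair v p && ~~ [exists r, light_ok u p r]].
have heavyS' w : w \in heavy G S v -> w \in S'.
  rewrite inE => /and3P[wS vw dw]; apply: mem_rest => //.
    by apply: contraTneq vw => ->; rewrite adj_irr.
  by rewrite inE wS vw leqNgt dw.
have cX : #|X| <= 3 * #|heavy G S v|.
  apply: card_bigcup_le => w wh; apply: card_heavy_bad (colf.1 w (heavyS' w wh)).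
  by move: wh; rewrite inE => /and3P[].
have cY : #|Y| <= 1 * #|light G S v| by apply: card_bigcup_le; apply: card_stuck_light.
have : 0 < #|[set p | color_pair v p] :\: (X :|: Y)|.
  rewrite cardsD card_color_pair subn_gt0.
  apply: leq_ltn_trans (subset_leq_card (subsetIr _ _)) _.
  by apply: leq_ltn_trans (leq_card_setU _ _) _; lia.
case/card_gt0P => p; rewrite in_setD in_setU negb_or inE => /andP[/andP[pX pY] pv].
have hp w : w \in heavy G S v -> compatible p (f w).
  move=> wh; apply: contraR pX => np; apply/bigcupP; exists w => //.
  by rewrite inE pv np.
have lp u : u \in light G S v -> [exists r, light_ok u p r].
  move=> ul; apply: contraR pY => np; apply/bigcupP; exists u => //.
  by rewrite inE pv np.
pose g u := odflt p [pick r | light_ok u p r].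
have gP u : u \in light G S v -> light_ok u p (g u).
  by rewrite /g => /lp /existsP[r rP]; case: pickP => //= /(_ r); rewrite rP.
pose f' x := if x == v then p else if x \in light G S v then g x else f x.
have f'v : f' v = p by rewrite /f' eqxx.
have lv u : u \in light G S v -> u != v.
  by apply: contraTneq => ->; rewrite inE adj_irr andbF.
have f'l u : u \in light G S v -> f' u = g u by move=> ul; rewrite /f' (negPf (lv u ul)) ul.
have from_light x y : x \in light G S v -> y \in S -> adj G x y ->
    compatible (f' x) (f' y).
  move=> xl yS xy; have /and3P[_ gp /forall_inP gw] := gP x xl; rewrite f'l //.
  have [->|yv] := eqVneq y v; first by rewrite f'v.
  have vx : adj G v x by move: xl; rewrite inE => /and3P[].
  have yl : y \notin light G S v by rewrite inE (triangle_free vx xy) andbF.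
  by rewrite /f' (negPf yv) (negPf yl) gw // in_setD1 yv yS.
have from_v y : y \in S -> adj G v y -> compatible (f' v) (f' y).
  move=> yS vy; have [yl|yl] := boolP (y \in light G S v).
    by rewrite compatibleC from_light // adj_sym.
  have yv : y != v by apply: contraTneq vy => ->; rewrite adj_irr.
  rewrite f'v /f' (negPf yv) (negPf yl) hp //.
  by move: yl; rewrite !inE yS vy -ltnNge.
exists f'; split=> [x xS|x y xS yS xy].
  have [->|xv] := eqVneq x v; first by rewrite f'v.
  have [xl|xl] := boolP (x \in light G S v).
    by rewrite f'l //; case/and3P: (gP x xl).
  by rewrite /f' (negPf xv) (negPf xl); apply/colf.1/mem_rest.
have [E|xv] := eqVneq x v; first by rewrite E in xy *; apply: from_v.
have [E|yv] := eqVneq y v.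
  by rewrite E compatibleC in xy *; apply: from_v => //; rewrite adj_sym.
have [xl|xl] := boolP (x \in light G S v); first exact: from_light.
have [yl|yl] := boolP (y \in light G S v).
  by rewrite compatibleC; apply: from_light => //; rewrite adj_sym.
rewrite /f' (negPf xv) (negPf yv) (negPf xl) (negPf yl).
by apply: colf.2 => //; apply: mem_rest.
Qed.

End Extension.

Lemma exists_disjoint_colorings S : planar G -> girth_ge G 8 ->
  exists f, disjoint_colorings S f.
Proof.
move=> pl girth.
have tri : girth_ge G 4 by move=> s u s3 c; apply: leq_trans (girth s u s3 c).
move: {2}#|S| (leqnn #|S|) => n; elim: n S => [|n IH] S Sn.
  (* [S] is empty here, yet [f] must be total; any colors do, even equal ones. *)
  have ne v : exists x, x \in L v by apply/card_gt0P; rewrite fold3.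
  exists (fun v => (xchoose (ne v), xchoose (ne v))).
  by move: Sn; rewrite leqn0 cards_eq0 => /eqP ->; split=> ?; rewrite inE.
have [->|S0] := eqVneq S set0; first by apply: IH; rewrite cards0.
have [v vS red] := exists_reducible pl girth S0.
have [|f colf] := IH (S :\ v :\: light G S v); last exact: extend_coloring colf red.
rewrite -ltnS (leq_trans _ Sn) // (cardsD1 v S) vS add1n ltnS.
exact/subset_leq_card/subsetDl.
Qed.

End Coloring.

(** * From color pairs to transversals *)

Theorem mainTheorem5 (T : finType) (G : sgraph T) :
  planar G -> girth_ge G 8 ->
  forall (HT : finType) (H : sgraph HT) (L : T -> {set HT}),
    corr_cover G H L -> k_fold L 3 ->
    exists I1 I2 : {set HT},
      [/\ indep_transversal H L I1, indep_transversal H L I2 &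
          [disjoint I1 & I2]].
Proof.
move=> pl girth HT H L cover fold3.
have [f [fL fH]] := exists_disjoint_colorings cover fold3 [set: T] pl girth.
have {}fL u : color_pair L u (f u) by apply: fL; rewrite inE.
have {}fH u w : adj G u w -> compatible H (f u) (f w) by apply: fH; rewrite inE.
have [_ dis _ nadj _] := cover.
have inj x u w : x \in L u -> x \in L w -> u = w.
  move=> xu xw; apply/eqP; apply: contraT => /dis/disjoint_setI0/setP/(_ x).
  by rewrite !inE xu xw.
have transversal (c : T -> HT) : (forall u, c u \in L u) ->
    (forall u w, adj G u w -> ~~ adj H (c u) (c w)) ->
  indep_transversal H L [set c u | u : T].
  move=> cL cH; split=> [_ _ /imsetP[u _ ->] /imsetP[w _ ->]|v].
    have [->|uw] := eqVneq u w; first by rewrite adj_irr.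
    have [/cH //|nuw] := boolP (adj G u w); exact: nadj nuw _ _.
  apply/eqP/cards1P; exists (c v); apply/setP => x; rewrite !inE.
  apply/andP/eqP => [[/imsetP[u _ ->] cv]|->]; last by rewrite imset_f.
  by rewrite (inj _ _ _ (cL u) cv).
exists [set (f u).1 | u : T], [set (f u).2 | u : T]; split.
- apply: transversal => [u|u w /fH /andP[]] //; by case/and3P: (fL u).
- apply: transversal => [u|u w /fH /andP[]] //; by case/and3P: (fL u).
(* The sets [L u] are disjoint, so a common element would be both colors of one vertex, which
   [color_pair] rules out. *)
- rewrite disjoint_subset; apply/subsetP => _ /imsetP[u _ ->]; rewrite inE.
  apply/imsetP => -[w _ E]; have /and3P[u1 _ uN] := fL u.
  have /and3P[_ w2 _] := fL w; rewrite -E in w2.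
  by move: uN; rewrite (inj _ _ _ u1 w2) -E (inj _ _ _ u1 w2) eqxx.
Qed.
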